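(* Let $AP(\mathbb Z)\subseteq\ell^\infty(\mathbb Z)$ be the C*-subalgebra generated by $\{x_\lambda:\lambda\in\mathbb T\}$. The $\mathbb Z$-injective envelope $I_{\mathbb Z}(AP(\mathbb Z))$ is strictly contained in $\ell^\infty(\mathbb Z)$ (i.e. it is not all of $\ell^\infty(\mathbb Z)$). Moreover, there is a unital, completely positive, idempotent linear map $\Phi:\ell^\infty(\mathbb Z)\to\ell^\infty(\mathbb Z)$ commuting with the backward shift, whose range is a C*-subalgebra $*$-isomorphic to $I_{\mathbb Z}(AP(\mathbb Z))$, which fixes $AP(\mathbb Z)$ pointwise, annihilates $c_0(\mathbb Z)$, and satisfies $\sigma(\Phi)=\mathbb T$.
   Context: $x_\lambda=(\lambda^n)_{n\in\mathbb Z}$, and $AP(\mathbb Z)$ is the algebra of almost periodic functions on $\mathbb Z$. $\mathbb Z$ acts on $\ell^\infty(\mathbb Z)$ by translation, generated by the backward shift $(Bv)_n=v_{n+1}$; a map is $\mathbb Z$-equivariant if it commutes with this action. A unital C*-algebra (or operator system) with a $\mathbb Z$-action is $\mathbb Z$-injective if every $\mathbb Z$-equivariant completely positive map into it from an equivariant operator subsystem extends equivariantly and completely positively to the larger system; $\ell^\infty(\mathbb Z)$ is $\mathbb Z$-injective. The $\mathbb Z$-injective envelope (Hamana) $I_{\mathbb Z}(\mathcal A)$ of $\mathcal A\subseteq\ell^\infty(\mathbb Z)$ is the range of a minimal $\mathbb Z$-equivariant unital completely positive idempotent on $\ell^\infty(\mathbb Z)$ fixing $\mathcal A$, a minimal $\mathbb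 Z$-injective extension of $\mathcal A$, unique up to equivariant complete order isomorphism fixing $\mathcal A$. For a $\mathbb Z$-equivariant $\Phi$, $\Phi(x_\lambda)=c_\lambda x_\lambda$ and $\sigma(\Phi)=\{\lambda:c_\lambda\ne0\}$. *)

(* Defs.v *)
From HB Require Import structures.
From mathcomp Require Import all_boot all_order all_algebra.
From mathcomp Require Import reals complex.
Set Implicit Arguments. Unset Strict Implicit. Unset Printing Implicit Defensive.
Import Order.TTheory GRing.Theory Num.Theory.
Local Open Scope ring_scope.

Section Defs.
Variable R : realType.
Local Notation C := (R[i]).

Definition seqZ := int -> C.

Definition bounded (f : seqZ) : Prop := exists M : C, forall n, `|f n| <= M.

Definition xl (l : C) : seqZ := fun n => l ^ n.

Definition one_s : seqZ := fun _ => 1.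
Definition zero_s : seqZ := fun _ => 0.
Definition mul_s (f g : seqZ) : seqZ := fun n => f n * g n.
Definition add_s (f g : seqZ) : seqZ := fun n => f n + g n.
Definition scale_s (a : C) (f : seqZ) : seqZ := fun n => a * f n.
Definition conj_s (f : seqZ) : seqZ := fun n => Num.conj (f n).

Definition bshift (f : seqZ) : seqZ := fun n => f (n + 1).

Definition Cstar_subalg (S : seqZ -> Prop) : Prop :=
  (forall f, S f -> bounded f) /\
  S one_s /\
  (forall f g, S f -> S g -> S (add_s f g)) /\
  (forall a f, S f -> S (scale_s a f)) /\
  (forall f g, S f -> S g -> S (mul_s f g)) /\
  (forall f, S f -> S (conj_s f)) /\
  (forall f, (forall eps : C, 0 < eps ->
                exists g, S g /\ forall n, `|f n - g n| <= eps) -> S f).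

Definition AP (f : seqZ) : Prop :=
  forall S, Cstar_subalg S -> (forall l : C, `|l| = 1 -> S (xl l)) -> S f.

Definition c0 (f : seqZ) : Prop :=
  forall eps : C, 0 < eps -> exists N : int, forall n : int, N < `|n| -> `|f n| < eps.

(* positivity in M_k(l^oo(Z)) = l^oo(Z, M_k): A = B^* B with B in M_k(l^oo(Z)) *)
Definition mx_bounded k (A : int -> 'M[C]_k) : Prop :=
  forall i j, bounded (fun n => A n i j).
Definition mx_positive k (A : int -> 'M[C]_k) : Prop :=
  exists B : int -> 'M[C]_k, mx_bounded B /\
    forall n, A n = (map_mx Num.conj (B n)^T) *m B n.

(* maps on l^oo(Z) (only their values on bounded sequences matter) *)
Definition linear_on (Phi : seqZ -> seqZ) : Prop :=
  (forall f, bounded f -> bounded (Phi f)) /\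
  (forall a f g, bounded f -> bounded g ->
     Phi (add_s (scale_s a f) g) = add_s (scale_s a (Phi f)) (Phi g)).

Definition amplify (Phi : seqZ -> seqZ) k (A : int -> 'M[C]_k) : int -> 'M[C]_k :=
  fun n => \matrix_(i, j) Phi (fun m => A m i j) n.

Definition completely_positive (Phi : seqZ -> seqZ) : Prop :=
  forall k (A : int -> 'M[C]_k), mx_bounded A -> mx_positive A ->
    mx_positive (amplify Phi A).

Definition UCP (Phi : seqZ -> seqZ) : Prop :=
  linear_on Phi /\ Phi one_s = one_s /\ completely_positive Phi.

Definition idem_map (Phi : seqZ -> seqZ) : Prop :=
  forall f, bounded f -> Phi (Phi f) = Phi f.

Definition Zequivariant (Phi : seqZ -> seqZ) : Prop :=
  forall f, bounded f -> Phi (bshift f) = bshift (Phi f).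

Definition rangeM (Phi : seqZ -> seqZ) (f : seqZ) : Prop :=
  exists g, bounded g /\ f = Phi g.

Definition AP_Zproj (Phi : seqZ -> seqZ) : Prop :=
  UCP Phi /\ idem_map Phi /\ Zequivariant Phi /\ (forall f, AP f -> Phi f = f).

(* minimal ones (Hamana order: phi <= psi iff phi psi = psi phi = phi);
   I_Z(AP(Z)) is the range of such a minimal projection *)
Definition minimal_AP_Zproj (Psi : seqZ -> seqZ) : Prop :=
  AP_Zproj Psi /\
  forall Phi, AP_Zproj Phi ->
    (forall f, bounded f -> Phi (Psi f) = Phi f /\ Psi (Phi f) = Phi f) ->
    forall f, bounded f -> Phi f = Psi f.

(* a *-isomorphism from rangeM Psi (with its Choi-Effros C*-structure,
   product f o g = Psi (f g)) onto rangeM Phi (with the product of l^oo) *)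
Definition star_iso (Psi Phi : seqZ -> seqZ) : Prop :=
  exists theta : seqZ -> seqZ,
    (forall f, rangeM Psi f -> rangeM Phi (theta f)) /\
    (forall a f g, rangeM Psi f -> rangeM Psi g ->
       theta (add_s (scale_s a f) g) = add_s (scale_s a (theta f)) (theta g)) /\
    (forall f g, rangeM Psi f -> rangeM Psi g ->
       theta (Psi (mul_s f g)) = mul_s (theta f) (theta g)) /\
    (forall f, rangeM Psi f -> theta (conj_s f) = conj_s (theta f)) /\
    theta one_s = one_s /\
    (forall f g, rangeM Psi f -> rangeM Psi g -> theta f = theta g -> f = g) /\
    (forall h, rangeM Phi h -> exists f, rangeM Psi f /\ theta f = h).

Definition in_sigma (Phi : seqZ -> seqZ) (l : C) : Prop :=
  `|l| = 1 /\ exists c : C, c != 0 /\ Phi (xl l) = scale_s c (xl l).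

End Defs.

(* Main.v *)
Require Import Defs.
From HB Require Import structures.
From mathcomp Require Import all_boot all_order all_algebra.
From mathcomp Require Import boolp classical_sets filter spectral sesquilinear.
From mathcomp Require Import reals complex.
From mathcomp Require Import zify ring.
Import Order.TTheory GRing.Theory Num.Theory.
Local Open Scope ring_scope.

(** An equivariant unital positive map on l^oo(Z) is automatically completely
    positive.  Among those fixing AP(Z) choose, by Zorn's lemma and ultrafilter
    limits, one with minimal seminorm [f |-> sup |G f|]; averaging its powers
    shows that it is idempotent, and then that it is rigid: [G P G = G] for
    every such map [P].  If [v] is a free ultrafilter on the naturals,
    [f |-> lim_m lim_k f(n + k - m)] along [v] fixes AP(Z) and kills c_0(Z);
    composing [G] with it gives a rigid map [Psi] killing c_0(Z), which is
    therefore minimal.  The identity is not minimal, as [Psi] lies below it.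

    To turn the Choi-Effros product of the range of [Psi] into the pointwise
    product, consider the sets [{m | q m < eps}] with [q >= 0] and
    [Psi q 0 = 0]: they form a filter base, since [q >= eps] would give
    [Psi q 0 >= eps].  Along an ultrafilter [U] containing them,
    [T f n = lim_(m -> U) f(n + m)] is multiplicative, fixes AP(Z), and
    identifies [Psi (a b)] with [a b] for [a], [b] in the range of [Psi],
    because [Psi] annihilates [|Psi (a b) - a b|^2].  By rigidity
    [Phi = T Psi] is idempotent and [T] is injective on the range of [Psi]. *)

(** * Limits along an ultrafilter *)

Section Ultralimit.
Set Implicit Arguments. Unset Strict Implicit. Unset Printing Implicit Defensive.
Variables (R : realType) (I : Type) (U : set_system I).
Local Notation C := (R[i]).
Local Notation "x %:C" := (real_complex R x) : ring_scope.
Local Open Scope classical_set_scope.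
Local Open Scope ring_scope.

Definition is_ulim (f : I -> C) (l : C) : Prop :=
  forall eps : C, 0 < eps -> U [set i | `|f i - l| < eps].

(** The default 0 is the value when no limit exists; [ulimP] excludes this for bounded [f] and an
    ultrafilter. *)
Definition ulim (f : I -> C) : C := xget 0 [set l | is_ulim f l].

Context {UU : UltraFilter U}.

Lemma is_ulim_cst c : is_ulim (fun=> c) c.
Proof.
move=> e e0; apply: (filterS _ filterT) => i _ /=.
by rewrite subrr normr0.
Qed.

Lemma is_ulimD f g l m :
  is_ulim f l -> is_ulim g m -> is_ulim (fun i => f i + g i) (l + m).
Proof.
move=> fl gm e e0.
have e20 : 0 < e / 2 by rewrite divr_gt0.
apply: (filterS2 _ _ (fl _ e20) (gm _ e20)) => i /= h1 h2.
have -> : f i + g i - (l + m) = (f i - l) + (g i - m) by ring.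
by apply: (le_lt_trans (ler_normD _ _)); rewrite [e]splitr ltrD.
Qed.

Lemma is_ulimM f g l m :
  is_ulim f l -> is_ulim g m -> is_ulim (fun i => f i * g i) (l * m).
Proof.
move=> fl gm e e0.
have k0 : 0 < 1 + `|l| + `|m| by rewrite -addrA ltr_wpDr ?addr_ge0.
(* This [d] is at most 1 and satisfies [d * (1 + |l| + |m|) < e], which controls all three terms of
   the expansion below. *)
pose d := e / (e + (1 + `|l| + `|m|)).
have ek0 : 0 < e + (1 + `|l| + `|m|) by rewrite addr_gt0.
have d0 : 0 < d by rewrite divr_gt0.
have d1 : d <= 1 by rewrite ler_pdivrMr // mul1r lerDl ltW.
apply: (filterS2 _ _ (fl _ d0) (gm _ d0)) => i /= h1 h2.
have -> : f i * g i - l * m = (f i - l) * (g i - m) + (f i - l) * m + l * (g i - m).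
  by ring.
apply: (le_lt_trans (ler_normD _ _)).
apply: (@le_lt_trans _ _ (d + d * `|m| + `|l| * d)).
  apply: lerD; last by rewrite normrM ler_wpM2l // ltW.
  apply: (le_trans (ler_normD _ _)); apply: lerD.
    rewrite normrM -[leRHS]mulr1; apply: ler_pM => //; first exact: ltW.
    by apply: le_trans d1; exact: ltW.
  by rewrite normrM ler_wpM2r // ltW.
have -> : d + d * `|m| + `|l| * d = d * (1 + `|l| + `|m|) by ring.
by rewrite /d mulrAC ltr_pdivrMr // ltr_pM2l // ltrDr.
Qed.

Lemma is_ulim_norm f l : is_ulim f l -> is_ulim (fun i => `|f i|) `|l|.
Proof.
move=> fl e e0; apply: filterS (fl e e0) => i /=.
by apply: le_lt_trans; exact: ler_dist_dist.
Qed.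

Lemma is_ulim_ext f g l : U [set i | f i = g i] -> is_ulim f l -> is_ulim g l.
Proof.
by move=> fg fl e e0; apply: (filterS2 _ _ fg (fl e e0)) => i /= ->.
Qed.

Lemma is_ulim_uniq f l m : is_ulim f l -> is_ulim f m -> l = m.
Proof.
move=> fl fm; apply/eqP; rewrite -subr_eq0 -normr_eq0; apply/negPn/negP => n0.
have e0 : 0 < `|l - m| / 2 by rewrite divr_gt0 // lt0r n0 normr_ge0.
have [i /= [h1 h2]] := filter_ex (filterI (fl _ e0) (fm _ e0)).
have : `|l - m| < `|l - m|.
  have {1}-> : l - m = (f i - m) - (f i - l) by ring.
  by apply: (le_lt_trans (ler_normB _ _)); rewrite [ltRHS]splitr ltrD.
by rewrite ltxx.
Qed.

(** Along the filter [f] agrees with [|f|], so its limit equals [|l|]; this gives reality and sign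
    at once. *)
Lemma is_ulim_ge0 f l : U [set i | 0 <= f i] -> is_ulim f l -> 0 <= l.
Proof.
move=> f0 fl; suff -> : l = `|l| by [].
apply: (is_ulim_uniq fl); apply: (is_ulim_ext _ (is_ulim_norm fl)).
by apply: filterS f0 => i /= /ger0_norm.
Qed.

Lemma is_ulim_norm_le f l M :
  U [set i | `|f i| <= M] -> is_ulim f l -> `|l| <= M.
Proof.
move=> fM fl; rewrite -subr_ge0.
apply: (@is_ulim_ge0 (fun i => M + -1 * `|f i|) (M - `|l|)).
  by apply: filterS fM => i /=; rewrite mulN1r subr_ge0.
rewrite -(mulN1r `|l|); apply: is_ulimD; first exact: is_ulim_cst.
by apply: is_ulimM; [exact: is_ulim_cst|exact: is_ulim_norm].
Qed.

(** The limit is the supremum of those [a] with [a <= f i] on a set of [U]. If the set where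
    [f i < sup A + r] were not in [U], its complement would be, and this would put [sup A + r] into
    [A]. *)
Lemma real_is_ulim_ex (f : I -> R) (M : R) :
  (forall i, `|f i| <= M) -> exists l : R, is_ulim (fun i => (f i)%:C) l%:C.
Proof.
move=> fM; pose A : set R := [set a | U [set i | a <= f i]].
have AM : A (- M).
  by apply: (filterS _ filterT) => i _ /=; move: (fM i); rewrite ler_norml => /andP[].
have ubA : ubound A M.
  move=> a /filter_ex [i /= ai]; apply: (le_trans ai).
  by move: (fM i); rewrite ler_norml => /andP[].
have supA : has_sup A by split; [exists (- M)|exists M].
exists (sup A) => e e0.
have [r re r0] : exists2 r : R, e = r%:C & 0 < r.
  exists (complex.Re e); first by rewrite RRe_real // gtr0_real.
  by move: e0; rewrite ltcE => /andP[_].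
have [a Aa lta] := sup_adherent r0 supA.
have UB : U [set i | f i < sup A + r].
  have [//|UN] := in_ultra_setVsetC [set i | f i < sup A + r] UU.
  have : A (sup A + r) by apply: filterS UN => i /= /negP; rewrite -leNgt.
  by move/(sup_upper_bound supA); rewrite gerDl leNgt r0.
apply: (filterS2 _ _ Aa UB) => i /= h1 h2.
rewrite re -rmorphB normc_def /= expr0n addr0 sqrtr_sqr ltcR ltr_distl.
by rewrite h2 andbT (lt_le_trans lta).
Qed.

Lemma ulimP (f : I -> C) :
  (exists M : C, forall i, `|f i| <= M) -> is_ulim f (ulim f).
Proof.
move=> [M fM]; rewrite /ulim; case: xgetP => [y _ //|H].
have Mr i : `|f i| <= (complex.Re M)%:C.
  by rewrite RRe_real // ger0_real // (le_trans _ (fM i)).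
have [l hl] : exists l : R, is_ulim (fun i => (complex.Re (f i))%:C) l%:C.
  apply: (@real_is_ulim_ex _ (complex.Re M)) => i; rewrite -lecR.
  exact: le_trans (normc_ge_Re _) (Mr i).
have [m hm] : exists l : R, is_ulim (fun i => (complex.Im (f i))%:C) l%:C.
  apply: (@real_is_ulim_ex _ (complex.Re M)) => i; rewrite -lecR.
  apply: le_trans (Mr i); rewrite normc_def lecR -sqrtr_sqr ler_wsqrtr //.
  by rewrite lerDr sqr_ge0.
exfalso; apply: (H (l%:C + 'i%C * m%:C)) => /=.
have -> : f = fun i => (complex.Re (f i))%:C + 'i%C * (complex.Im (f i))%:C.
  by apply: funext => i; exact: complexE.
by apply: is_ulimD => //; apply: is_ulimM => //; exact: is_ulim_cst.
Qed.

End Ultralimit.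

(** * Positive equivariant maps *)

(** Spectral theorem: with [A = P^* D P], the form at row [i] of [P] is the eigenvalue [D_i], hence
    nonnegative, and [B] is [D^(1/2) P]. *)
Lemma psd_factor (F : numClosedFieldType) k (A : 'M[F]_k) :
  (forall i j, A j i = (A i j)^*) ->
  (forall v : 'rV[F]_k, 0 <= \sum_i \sum_j v 0 i * A i j * (v 0 j)^*) ->
  exists B : 'M[F]_k, A = (map_mx Num.conj B^T) *m B.
Proof.
move=> Ah Ap.
have Aherm : A \is hermsymmx.
  apply/is_hermitianmxP; rewrite expr0 scale1r; apply/matrixP => i j.
  by rewrite !mxE (Ah j i) .
have := hermitian_normalmx Aherm => /orthomx_spectralP.
set P := spectralmx A; set D := spectral_diag A => AE.
have Pu : P \is unitarymx := spectral_unitarymx A.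
rewrite (invmx_unitary Pu) in AE.
have D0 i : 0 <= D 0 i.
  have Di : (P *m A *m map_mx Num.conj P^T) i i = D 0 i.
    have -> : P *m A *m map_mx Num.conj P^T = diag_mx D.
      rewrite AE !mulmxA (unitarymxP Pu) mul1mx -mulmxA.
      by rewrite (unitarymxP Pu) mulmx1.
    by rewrite mxE eqxx mulr1n.
  rewrite -Di.
  have := Ap (row i P); congr (_ <= _).
  rewrite !mxE exchange_big /=; apply: eq_bigr => j _.
  rewrite !mxE big_distrl /=; apply: eq_bigr => l _.
  by rewrite !mxE.
exists (diag_mx (map_mx sqrtC D) *m P).
rewrite trmx_mul map_mxM tr_diag_mx map_diag_mx {1}AE.
rewrite -!mulmxA; congr (_ *m _); rewrite !mulmxA; congr (_ *m _).
rewrite mulmx_diag; congr diag_mx; apply/rowP => i; rewrite !mxE.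
have s0 : 0 <= sqrtC (D 0 i) by rewrite sqrtC_ge0.
by rewrite [X in X * _](conj_Creal (ger0_real s0)) -expr2 sqrtCK.
Qed.

(** Turns a bound [M] on a square into the bound [1 + M] on the number itself. *)
Lemma le_sqr_add1 (F : numDomainType) (M : F) : 0 <= M -> M <= (1 + M) ^+ 2.
Proof.
move=> M0; rewrite -subr_ge0.
have -> : (1 + M) ^+ 2 - M = 1 + M + M ^+ 2 by ring.
by rewrite !addr_ge0 ?exprn_ge0.
Qed.

Section PositiveMaps.
Set Implicit Arguments. Unset Strict Implicit. Unset Printing Implicit Defensive.
Variable R : realType.
Local Notation C := (R[i]).
Implicit Types (f g h : seqZ R) (Phi Psi : seqZ R -> seqZ R).

Definition cst_s (c : C) : seqZ R := fun=> c.
Definition sub_s f g : seqZ R := fun n => f n - g n.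
Definition translate (m : int) f : seqZ R := fun n => f (n + m).
Definition sqn_s f : seqZ R := mul_s f (conj_s f).

Lemma bounded_cst c : bounded (cst_s c).
Proof. by exists `|c|. Qed.

Lemma bounded_add f g : bounded f -> bounded g -> bounded (add_s f g).
Proof.
move=> [M fM] [N gN]; exists (M + N) => n.
by apply: (le_trans (ler_normD _ _)); exact: lerD.
Qed.

Lemma bounded_mul f g : bounded f -> bounded g -> bounded (mul_s f g).
Proof.
by move=> [M fM] [N gN]; exists (M * N) => n; rewrite normrM ler_pM.
Qed.

Lemma sub_sE f g : sub_s f g = add_s (scale_s (-1) g) f.
Proof. by apply: funext => n; rewrite /add_s /scale_s mulN1r addrC. Qed.

Lemma bounded_scale c f : bounded f -> bounded (scale_s c f).
Proof. by move=> bf; apply: bounded_mul => //; exact: bounded_cst. Qed.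

Lemma bounded_sub f g : bounded f -> bounded g -> bounded (sub_s f g).
Proof. by move=> bf bg; rewrite sub_sE; apply: bounded_add => //; exact: bounded_scale. Qed.

Lemma bounded_conj f : bounded f -> bounded (conj_s f).
Proof. by move=> [M fM]; exists M => n; rewrite norm_conjC. Qed.

Lemma bounded_translate m f : bounded f -> bounded (translate m f).
Proof. by move=> [M fM]; exists M => n; exact: fM. Qed.

Lemma bounded_sqn f : bounded f -> bounded (sqn_s f).
Proof. by move=> bf; apply: bounded_mul => //; exact: bounded_conj. Qed.

Lemma sqn_s_ge0 f n : 0 <= sqn_s f n.
Proof. by rewrite /sqn_s /mul_s mul_conjC_ge0. Qed.

(** Positivity on sequences is the working notion: it passes easily to compositions, averages and
    pointwise limits, and [eqpos_CP] recovers complete positivity. *)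
Record eqpos Phi : Prop := EqPos {
  eqpos_lin : linear_on Phi;
  eqpos_one : Phi (one_s R) = one_s R;
  eqpos_ge0 : forall f, bounded f -> (forall n, 0 <= f n) -> forall n, 0 <= Phi f n;
  eqpos_shift : Zequivariant Phi }.

Section Theory.
Variables (Phi : seqZ R -> seqZ R) (hPhi : eqpos Phi).

Lemma eqpos_bounded f : bounded f -> bounded (Phi f).
Proof. exact: (eqpos_lin hPhi).1. Qed.

Lemma eqposD f g : bounded f -> bounded g ->
  Phi (add_s f g) = add_s (Phi f) (Phi g).
Proof.
move=> bf bg; have := (eqpos_lin hPhi).2 1 f g bf bg.
rewrite /scale_s; under eq_fun do rewrite mul1r.
by move=> ->; apply: funext => n; rewrite /add_s mul1r.
Qed.

Lemma eqposB f g : bounded f -> bounded g ->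
  Phi (sub_s f g) = sub_s (Phi f) (Phi g).
Proof. by move=> bf bg; rewrite !sub_sE (eqpos_lin hPhi).2. Qed.

Lemma eqpos0 : Phi (zero_s R) = zero_s R.
Proof.
have b1 := bounded_cst 1.
have -> : zero_s R = sub_s (one_s R) (one_s R).
  by apply: funext => n; rewrite /sub_s subrr.
rewrite eqposB //; apply: funext => n; rewrite /sub_s subrr.
by rewrite /one_s subrr.
Qed.

Lemma eqposZ a f : bounded f -> Phi (scale_s a f) = scale_s a (Phi f).
Proof.
move=> bf; have := (eqpos_lin hPhi).2 a f (zero_s R) bf (bounded_cst 0).
rewrite eqpos0.
have E h : add_s h (zero_s R) = h by apply: funext => n; rewrite /add_s addr0.
by rewrite !E.
Qed.

Lemma eqpos_cst c : Phi (cst_s c) = cst_s c.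
Proof.
have -> : cst_s c = scale_s c (one_s R).
  by apply: funext => n; rewrite /scale_s /one_s mulr1.
by rewrite eqposZ ?(eqpos_one hPhi) //; exact: bounded_cst.
Qed.

Lemma eqpos_le f g n : bounded f -> bounded g -> (forall k, f k <= g k) ->
  Phi f n <= Phi g n.
Proof.
move=> bf bg fg; rewrite -subr_ge0.
have := eqpos_ge0 hPhi (bounded_sub bg bf) _ n; rewrite eqposB //; apply => k.
by rewrite subr_ge0.
Qed.

Lemma eqpos_real f n : bounded f -> (forall k, f k \is Num.real) ->
  Phi f n \is Num.real.
Proof.
move=> bf fr; have [M fM] := bf.
have M0 : M \is Num.real by rewrite ger0_real // (le_trans _ (fM 0)).
have -> : Phi f n = M - Phi (sub_s (cst_s M) f) n.
  by rewrite eqposB ?eqpos_cst //; [rewrite /sub_s /cst_s; ring|exact: bounded_cst].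
rewrite rpredB // ger0_real //; apply: (eqpos_ge0 hPhi).
  by apply: bounded_sub => //; exact: bounded_cst.
move=> k; rewrite subr_ge0; apply: le_trans (fM k); exact: real_ler_norm.
Qed.

Lemma eqpos_conj f : bounded f -> Phi (conj_s f) = conj_s (Phi f).
Proof.
move=> bf; have [M fM] := bf.
pose a : seqZ R := fun n => 'Re (f n); pose b : seqZ R := fun n => 'Im (f n).
have ba : bounded a.
  by exists M => n; apply: le_trans (fM n); exact: leif_normC_Re_Creal.
have bb : bounded b.
  exists M => n; apply: le_trans (fM n); rewrite /b.
  rewrite -[leRHS](normrN) -[leRHS]mul1r -(normCi C) -normrM.
  rewrite (_ : 'Im (f n) = 'Re ('i * - f n)); first exact: leif_normC_Re_Creal.
  by rewrite mulrN raddfN /= mulrC ReMir opprK.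
have fE : f = add_s (scale_s 'i b) a.
  by apply: funext => n; rewrite /add_s /scale_s /a /b addrC -Crect.
have cE : conj_s f = add_s (scale_s (- 'i) b) a.
  apply: funext => n; rewrite /add_s /scale_s /a /b /conj_s {1}[f n]Crect.
  by rewrite conjC_rect ?Creal_Re ?Creal_Im // addrC mulNr.
rewrite cE (eqpos_lin hPhi).2 // [in RHS]fE (eqpos_lin hPhi).2 //.
apply: funext => n; rewrite /add_s /scale_s /conj_s addrC [in RHS]addrC.
rewrite conjC_rect ?mulNr //; apply: eqpos_real => // k.
  exact: Creal_Re.
exact: Creal_Im.
Qed.

(** Kadison-Schwarz inequality, as a variance: with [c = Phi f n], the nonnegative number
    [Phi (|f - c|^2) n] equals [Phi (|f|^2) n - |c|^2]. *)
Lemma eqpos_schwarz f n : bounded f -> sqn_s (Phi f) n <= Phi (sqn_s f) n.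
Proof.
move=> bf; set c := Phi f n.
have bc := bounded_conj bf; have bs := bounded_sqn bf.
have E : sqn_s (sub_s f (cst_s c)) =
  add_s (scale_s (- c^*) f) (add_s (scale_s (- c) (conj_s f)) (add_s (cst_s (c * c^*)) (sqn_s f))).
  apply: funext => k; rewrite /sqn_s /mul_s /conj_s /sub_s /add_s /scale_s /cst_s rmorphB /=.
  by ring.
have b1 : bounded (add_s (cst_s (c * c^*)) (sqn_s f)).
  by apply: bounded_add => //; exact: bounded_cst.
have b2 : bounded (add_s (scale_s (- c) (conj_s f)) (add_s (cst_s (c * c^*)) (sqn_s f))).
  by apply: bounded_add => //; exact: bounded_scale.
have : 0 <= Phi (sqn_s (sub_s f (cst_s c))) n.
  apply: (eqpos_ge0 hPhi); last exact: sqn_s_ge0.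
  by apply: bounded_sqn; apply: bounded_sub => //; exact: bounded_cst.
rewrite E (eqpos_lin hPhi).2 // (eqpos_lin hPhi).2 // eqposD //; last exact: bounded_cst.
rewrite eqpos_cst eqpos_conj // => P0; rewrite -subr_ge0; move: P0; congr (_ <= _).
rewrite /add_s /scale_s /cst_s /sqn_s /mul_s /conj_s -/c; ring.
Qed.

Lemma eqpos_contr f M : bounded f -> (forall n, `|f n| <= M) ->
  forall n, `|Phi f n| <= M.
Proof.
move=> bf fM n; have M0 : 0 <= M := le_trans (normr_ge0 _) (fM 0).
rewrite -(@ler_pXn2r _ 2) ?nnegrE ?normr_ge0 // normCK.
apply: (le_trans (eqpos_schwarz n bf)).
apply: (@le_trans _ _ (Phi (cst_s (M ^+ 2)) n)); last by rewrite eqpos_cst.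
apply: eqpos_le; [exact: bounded_sqn|exact: bounded_cst|] => k.
by rewrite /sqn_s /mul_s /conj_s /cst_s -normCK ler_pXn2r ?nnegrE ?normr_ge0.
Qed.

Lemma eqpos_translate m f : bounded f ->
  Phi (translate m f) = translate m (Phi f).
Proof.
have P (k : nat) g : bounded g -> Phi (translate k g) = translate k (Phi g).
  elim: k g => [|k IH] g bg.
    have E h : translate 0%N h = h by apply: funext => n; rewrite /translate addr0.
    by rewrite !E.
  have E h : translate k.+1 h = bshift (translate k h).
    by apply: funext => n; rewrite /translate /bshift -addrA -PoszD add1n.
  by rewrite !E (eqpos_shift hPhi) ?IH //; exact: bounded_translate.
move=> bf; case: (intP m) => [|k|k]; [exact: P|exact: P|].
have E h : translate k.+1 (translate (- k.+1%:Z) h) = h.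
  by apply: funext => n; rewrite /translate -addrA subrr addr0.
have E' h : translate (- k.+1%:Z) (translate k.+1 h) = h.
  by apply: funext => n; rewrite /translate -addrA addNr addr0.
rewrite -[in RHS](E f) P ?E' //; exact: bounded_translate.
Qed.

End Theory.

(** Positivity can be tested pointwise: for a fixed row [v], the quadratic form of [amplify Phi A n]
    at [v] is the value at [n] of [Phi] on the sequence of forms of [A] at [v], which is
    nonnegative. *)
Lemma eqpos_CP Phi : eqpos Phi -> completely_positive Phi.
Proof.
move=> hP k A bA [B [bB AE]].
have F n : exists D : 'M[C]_k, amplify Phi A n = (map_mx Num.conj D^T) *m D.
  apply: psd_factor => [i j|v].
    rewrite !mxE -[RHS]/(conj_s (Phi (fun m => A m i j)) n) -eqpos_conj //.
    congr (Phi _ n); apply: funext => m; rewrite /conj_s AE !mxE rmorph_sum.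
    by apply: eq_bigr => l _; rewrite !mxE rmorphM /= conjCK mulrC.
  have bs (r : seq 'I_k) (G : 'I_k -> seqZ R) : (forall i, bounded (G i)) ->
      bounded (fun m => \sum_(i <- r) G i m) /\
      Phi (fun m => \sum_(i <- r) G i m) = (fun m => \sum_(i <- r) Phi (G i) m).
    move=> bG; elim: r => [|i r [IH1 IH2]].
      have -> : (fun m => \sum_(i <- [::]) G i m) = zero_s R.
        by apply: funext => m; rewrite big_nil.
      split; first exact: bounded_cst.
      by rewrite eqpos0 //; apply: funext => m; rewrite big_nil.
    have -> : (fun m => \sum_(i <- i :: r) G i m) = add_s (G i) (fun m => \sum_(i <- r) G i m).
      by apply: funext => m; rewrite big_cons.
    split; first exact: bounded_add.
    by rewrite eqposD // IH2; apply: funext => m; rewrite big_cons.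
  have bt i j : bounded (scale_s (v 0 i * (v 0 j)^*) (fun m => A m i j)).
    exact: bounded_scale.
  have bt' i := (bs (index_enum _) _ (bt i)).1.
  have [bb E] := bs (index_enum _) _ bt'.
  have := eqpos_ge0 hP bb _ n; rewrite E => H.
  have -> : \sum_i \sum_j v 0 i * amplify Phi A n i j * (v 0 j)^* =
    \sum_i Phi (fun m => \sum_j scale_s (v 0 i * (v 0 j)^*) (fun m => A m i j) m) n.
    apply: eq_bigr => i _; rewrite (bs _ _ (bt i)).2; apply: eq_bigr => j _.
    by rewrite eqposZ // mxE /scale_s mulrAC.
  apply: H => m.
  (* As [A = B^* B], the form is the sum over [l] of [|sum_i v_i conj(B_li)|^2]. *)
  have -> : \sum_i \sum_j scale_s (v 0 i * (v 0 j)^*) (fun m0 => A m0 i j) m =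
     \sum_l ((\sum_i v 0 i * (B m l i)^*) * (\sum_i v 0 i * (B m l i)^*)^*).
    under [RHS]eq_bigr do rewrite rmorph_sum big_distrlr /=.
    rewrite [RHS]exchange_big; apply: eq_bigr => i _.
    rewrite [RHS]exchange_big; apply: eq_bigr => j _.
    rewrite /scale_s AE !mxE mulr_sumr; apply: eq_bigr => l _.
    rewrite !mxE rmorphM /= conjCK; ring.
  by apply: sumr_ge0 => l _; exact: mul_conjC_ge0.
pose D n := xget 0 [set D : 'M[C]_k | amplify Phi A n = (map_mx Num.conj D^T) *m D].
have FE n : amplify Phi A n = (map_mx Num.conj (D n)^T) *m D n.
  by rewrite /D; case: xgetP => [X _ //|H]; have [X /H] := F n.
exists D; split=> // i j.
(* The squared moduli in column [j] of [D n] sum to the diagonal entry [(j, j)] of the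
   amplification, so the chosen factors are bounded uniformly in [n]. *)
have [M hM] := eqpos_bounded hP (bA j j).
exists (1 + M) => n; have DE := FE n.
have M0 : 0 <= M := le_trans (normr_ge0 _) (hM 0).
have hD : `|D n i j| ^+ 2 <= M.
  apply: le_trans (hM n).
  have -> : Phi (fun m => A m j j) n = \sum_l `|D n l j| ^+ 2.
    have := congr1 (fun X : 'M_k => X j j) DE; rewrite !mxE => ->.
    by apply: eq_bigr => l _; rewrite !mxE mulrC normCK.
  rewrite [leRHS]ger0_norm ?sumr_ge0 // => [|l _]; last exact: exprn_ge0.
  rewrite (bigD1 i) //= lerDl sumr_ge0 // => l _; exact: exprn_ge0.
rewrite -(@ler_pXn2r _ 2) ?nnegrE ?normr_ge0 ?addr_ge0 //.
apply: (le_trans hD); exact: le_sqr_add1.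
Qed.

Lemma CP_ge0 Phi f : completely_positive Phi -> bounded f ->
  (forall n, 0 <= f n) -> forall n, 0 <= Phi f n.
Proof.
move=> cp [M bf] f0 n.
have [||D [_ /(_ n) DE]] := cp 1%N (fun n => (f n)%:M) _ _.
- by move=> i j; exists M => m; rewrite !ord1 mxE eqxx mulr1n.
- exists (fun m => (sqrtC (f m))%:M); split=> [i j|m].
    exists (1 + M) => m; rewrite !ord1 mxE eqxx mulr1n.
    have M0 : 0 <= M := le_trans (normr_ge0 _) (bf 0).
    rewrite -(@ler_pXn2r _ 2) ?nnegrE ?normr_ge0 ?addr_ge0 // -normrX sqrtCK.
    apply: (le_trans (bf m)); exact: le_sqr_add1.
  apply/matrixP => i j; rewrite !ord1 !mxE big_ord1 !mxE eqxx !mulr1n.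
  have s0 : 0 <= sqrtC (f m) by rewrite sqrtC_ge0.
  by rewrite [X in X * _](conj_Creal (ger0_real s0)) -expr2 sqrtCK.
have := congr1 (fun X : 'M_1 => X 0 0) DE; rewrite !mxE big_ord1 !mxE.
under [X in Phi X]eq_fun do rewrite mxE eqxx mulr1n.
by move=> ->; rewrite mulrC mul_conjC_ge0.
Qed.

End PositiveMaps.

(** * Maps fixing the almost periodic functions *)

Section EquivariantMaps.
Set Implicit Arguments. Unset Strict Implicit. Unset Printing Implicit Defensive.
Variable R : realType.
Local Notation C := (R[i]).
Local Open Scope classical_set_scope.
Local Open Scope ring_scope.
Implicit Types (f g h : seqZ R) (Phi Psi : seqZ R -> seqZ R).

Lemma eqpos_comp Phi Psi : eqpos Phi -> eqpos Psi -> eqpos (fun f => Phi (Psi f)).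
Proof.
move=> hP hQ; have bQ := eqpos_bounded hQ; split.
- split=> [f bf|a f g bf bg]; first by apply: (eqpos_bounded hP); exact: bQ.
  by rewrite (eqpos_lin hQ).2 // (eqpos_lin hP).2 //; exact: bQ.
- by rewrite (eqpos_one hQ) (eqpos_one hP).
- move=> f bf f0; apply: (eqpos_ge0 hP); first exact: bQ.
  exact: (eqpos_ge0 hQ).
- by move=> f bf; rewrite (eqpos_shift hQ) // (eqpos_shift hP) //; exact: bQ.
Qed.

Definition mid_map Phi Psi f : seqZ R := scale_s (2^-1) (add_s (Phi f) (Psi f)).

Lemma eqpos_mid Phi Psi : eqpos Phi -> eqpos Psi -> eqpos (mid_map Phi Psi).
Proof.
move=> hP hQ; split.
- split=> [f bf|a f g bf bg].
    by apply: bounded_scale; apply: bounded_add; exact: eqpos_bounded.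
  rewrite /mid_map (eqpos_lin hQ).2 // (eqpos_lin hP).2 //.
  by apply: funext => n; rewrite /scale_s /add_s; ring.
- rewrite /mid_map (eqpos_one hQ) (eqpos_one hP).
  by apply: funext => n; rewrite /scale_s /add_s /one_s; field.
- move=> f bf f0 n; rewrite /mid_map /scale_s /add_s.
  by rewrite mulr_ge0 ?invr_ge0 // addr_ge0 //; exact: eqpos_ge0.
- by move=> f bf; rewrite /mid_map (eqpos_shift hQ) // (eqpos_shift hP).
Qed.

Lemma eqpos_translate_map m : eqpos (@translate R m).
Proof.
split.
- by split=> // f; exact: bounded_translate.
- by [].
- by move=> f _ f0 n; exact: f0.
- by move=> f _; apply: funext => n; rewrite /translate /bshift addrAC.
Qed.

Section UltralimitMap.
Variables (I : Type) (U : set_system I).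
Context {UU : UltraFilter U}.
Variable phi : I -> seqZ R -> seqZ R.
Hypothesis hphi : forall i, eqpos (phi i).

Definition ulim_map f : seqZ R := fun n => ulim U (fun i => phi i f n).

Lemma ulim_mapP f n : bounded f -> is_ulim U (fun i => phi i f n) (ulim_map f n).
Proof.
by move=> bf; have [M fM] := bf; apply: ulimP; exists M => i; apply: (eqpos_contr (hphi i)).
Qed.

Lemma ulim_mapE f n l : bounded f -> is_ulim U (fun i => phi i f n) l ->
  ulim_map f n = l.
Proof. by move=> bf; apply: is_ulim_uniq; exact: ulim_mapP. Qed.

Lemma eqpos_ulim : eqpos ulim_map.
Proof.
split.
- split=> [f bf|a f g bf bg].
    have [M fM] := bf; exists M => n; apply: is_ulim_norm_le (ulim_mapP n bf).
    by apply: filterS filterT => i _ /=; exact: (eqpos_contr (hphi i)).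
  apply: funext => n; apply: ulim_mapE.
    by apply: bounded_add => //; exact: bounded_scale.
  have -> : (fun i => phi i (add_s (scale_s a f) g) n) = (fun i => a * phi i f n + phi i g n).
    by apply: funext => i; rewrite (eqpos_lin (hphi i)).2.
  apply: is_ulimD; last exact: ulim_mapP.
  by apply: is_ulimM; [exact: is_ulim_cst|exact: ulim_mapP].
- apply: funext => n; apply: ulim_mapE; first exact: bounded_cst.
  under eq_fun do rewrite (eqpos_one (hphi _)).
  exact: is_ulim_cst.
- move=> f bf f0 n; apply: is_ulim_ge0 (ulim_mapP n bf).
  by apply: filterS filterT => i _ /=; exact: (eqpos_ge0 (hphi i)).
- move=> f bf; apply: funext => n; apply: ulim_mapE; first exact: bounded_translate.
  under eq_fun do rewrite (eqpos_shift (hphi _)) //.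
  exact: ulim_mapP.
Qed.

Definition multiplicative_map Phi := forall f g, bounded f -> bounded g ->
  Phi (mul_s f g) = mul_s (Phi f) (Phi g).

Lemma ulim_map_mul : (forall i, multiplicative_map (phi i)) ->
  multiplicative_map ulim_map.
Proof.
move=> mphi f g bf bg; apply: funext => n; apply: ulim_mapE; first exact: bounded_mul.
under eq_fun do rewrite mphi //.
by apply: is_ulimM; exact: ulim_mapP.
Qed.

End UltralimitMap.

(** * The algebra of almost periodic sequences *)

Lemma AP_bounded f : AP f -> bounded f.
Proof.
move=> /(_ (@bounded R)); apply.
  split=> //; split; first exact: bounded_cst.
  split; first exact: bounded_add.
  split; first exact: bounded_scale.
  split; first exact: bounded_mul.
  split; first exact: bounded_conj.
  move=> f' /(_ 1 ltr01) [g [[M gM] fg]]; exists (1 + M) => n.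
  by rewrite -(subrK (g n) (f' n)); apply: (le_trans (ler_normD _ _)); exact: lerD.
move=> l l1; exists 1 => -[n|n].
  by rewrite normrX l1 expr1n.
by rewrite /xl NegzE -exprnN normfV normrX l1 expr1n invr1.
Qed.

Lemma AP_Cstar : Cstar_subalg (@AP R).
Proof.
split; first exact: AP_bounded.
split; first by move=> S hS _; apply: hS.2.1.
split; first by move=> f g Af Ag S hS hl; apply: hS.2.2.1; [exact: Af|exact: Ag].
split; first by move=> a f Af S hS hl; apply: hS.2.2.2.1; exact: Af.
split; first by move=> f g Af Ag S hS hl; apply: hS.2.2.2.2.1; [exact: Af|exact: Ag].
split; first by move=> f Af S hS hl; apply: hS.2.2.2.2.2.1; exact: Af.
move=> f Hf S hS hl; apply: hS.2.2.2.2.2.2 => e e0.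
by have [g [Ag fg]] := Hf e e0; exists g; split=> //; exact: Ag.
Qed.

Lemma AP_sub_cst f c : AP f -> AP (sub_s f (cst_s c)).
Proof.
move=> Af; have [_ [A1 [AD [AZ _]]]] := AP_Cstar.
rewrite sub_sE; apply: (AD) => //; apply: (AZ).
have -> : cst_s c = scale_s c (one_s R) by apply: funext => n; rewrite /scale_s mulr1.
exact: AZ.
Qed.

Lemma AP_sqn f : AP f -> AP (sqn_s f).
Proof.
by move=> Af; have [_ [_ [_ [_ [AM [AJ _]]]]]] := AP_Cstar; apply: AM => //; exact: AJ.
Qed.

Lemma AP_xl (l : C) : `|l| = 1 -> AP (xl l).
Proof. by move=> l1 S _; apply. Qed.

(** [Phi] is contractive, so its fixed points are uniformly closed: if [d = |Phi f n - f n|] were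
    positive, a fixed [g] within [d / 3] of [f] would give [d <= 2 d / 3]. *)
Lemma eqpos_fixed_closed Phi f : eqpos Phi ->
  (forall eps : C, 0 < eps -> exists g, (bounded g /\ Phi g = g) /\
     forall n, `|f n - g n| <= eps) -> bounded f /\ Phi f = f.
Proof.
move=> hP H; have bf : bounded f.
  have [g [[[M gM] _] fg]] := H 1 ltr01; exists (1 + M) => n.
  by rewrite -(subrK (g n) (f n)); apply: (le_trans (ler_normD _ _)); exact: lerD.
split=> //; apply: funext => n; apply/eqP; rewrite -subr_eq0 -normr_eq0.
apply/negPn/negP => n0; set d := `|_| in n0.
have d0 : 0 < d by rewrite lt0r n0 normr_ge0.
have d3 : 0 < d / 3 by rewrite divr_gt0.
have [g [[bg gE] fg]] := H _ d3.
have := eqpos_contr hP (bounded_sub bf bg) fg n; rewrite eqposB // gE /sub_s => h1.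
have : d <= d / 3 + d / 3.
  rewrite {1}/d; have -> : Phi f n - f n = (Phi f n - g n) - (f n - g n) by ring.
  by apply: (le_trans (ler_normB _ _)); exact: lerD.
have -> : d / 3 + d / 3 = d - d / 3 by field.
by rewrite lerDl oppr_ge0 (lt_geF d3).
Qed.

Definition APmap Phi := eqpos Phi /\ forall f, AP f -> Phi f = f.

(** The bounded fixed points of a multiplicative [Phi] form a C*-subalgebra; as it contains the
    characters, it contains AP(Z). *)
Lemma multiplicative_APmap Phi : eqpos Phi -> multiplicative_map Phi ->
  (forall l : C, `|l| = 1 -> Phi (xl l) = xl l) -> APmap Phi.
Proof.
move=> hP mP xP; split=> // f.
suff H : Cstar_subalg (fun f => bounded f /\ Phi f = f).
  by move=> Af; apply: (Af _ H _).2 => l l1; split; [apply: AP_bounded; exact: AP_xl|exact: xP].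
split; first by move=> g [].
split; first by split; [exact: bounded_cst|exact: eqpos_one].
split; first by move=> g h [bg gE] [bh hE]; rewrite eqposD // gE hE; split=> //; exact: bounded_add.
split; first by move=> a g [bg gE]; rewrite eqposZ // gE; split=> //; exact: bounded_scale.
split; first by move=> g h [bg gE] [bh hE]; rewrite mP // gE hE; split=> //; exact: bounded_mul.
split; first by move=> g [bg gE]; rewrite eqpos_conj // gE; split=> //; exact: bounded_conj.
by move=> g; exact: eqpos_fixed_closed.
Qed.

Lemma APmap_comp Phi Psi : APmap Phi -> APmap Psi -> APmap (fun f => Phi (Psi f)).
Proof.
move=> [hP fP] [hQ fQ]; split; first exact: eqpos_comp.
by move=> f Af; rewrite fQ // fP.
Qed.

Lemma APmap_mid Phi Psi : APmap Phi -> APmap Psi -> APmap (mid_map Phi Psi).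
Proof.
move=> [hP fP] [hQ fQ]; split; first exact: eqpos_mid.
move=> f Af; rewrite /mid_map fQ // fP //.
by apply: funext => n; rewrite /scale_s /add_s; field.
Qed.

Lemma APmap_id : APmap id.
Proof. by []. Qed.

Lemma APmap_ulim I (U : set_system I) (phi : I -> seqZ R -> seqZ R) :
  UltraFilter U -> (forall i, APmap (phi i)) -> APmap (ulim_map U phi).
Proof.
move=> UU hphi; split; first by apply: eqpos_ulim => i; exact: (hphi i).1.
move=> f Af; apply: funext => n; apply: ulim_mapE => [i||].
- exact: (hphi i).1.
- exact: AP_bounded.
- under eq_fun do rewrite (hphi _).2 //; exact: is_ulim_cst.
Qed.

Lemma ultrafilter_of_base I T (D : set I) (B : I -> set T) :
  (exists i, D i) ->
  (forall i j, D i -> D j -> exists2 k, D k & B k `<=` B i `&` B j) ->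
  (forall i, D i -> B i !=set0) ->
  exists U, UltraFilter U /\ forall i, D i -> U (B i).
Proof.
move=> D0 DI B0; have F := filter_from_filter D0 DI.
have PF := filter_from_proper F B0.
have [U [UU FU]] := ultraFilterLemma PF.
by exists U; split=> // i Di; apply: FU; exists i.
Qed.

(** * Annihilating the sequences that vanish at infinity *)

Lemma c0_bounded f : c0 f -> bounded f.
Proof.
move=> /(_ 1 ltr01) [N fN].
(* Beyond [|N|] the values are below 1 in modulus; the sum dominates the finitely many others. *)
exists (1 + \sum_(i < `|N|.+1) (`|f i| + `|f (- i%:Z)|)) => n.
have [Nn|nN] := ltP N `|n|.
  apply: (le_trans (ltW (fN n Nn))); rewrite lerDl sumr_ge0 // => i _.
  by rewrite addr_ge0.
have lt : (`|n| < `|N|.+1)%N by lia.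
have S0 : 0 <= \sum_(i < `|N|.+1 | i != Ordinal lt) (`|f i| + `|f (- i%:Z)|).
  by apply: sumr_ge0 => i _; rewrite addr_ge0.
rewrite (bigD1 (Ordinal lt)) //=.
apply: (@le_trans _ _ (`|f `|n|%N| + `|f (- `|n|%N%:Z)|)).
  have [->|->] : n = `|n|%N \/ n = - `|n|%N%:Z by lia.
    by rewrite absz_nat lerDl.
  by rewrite abszN absz_nat lerDr.
by rewrite addrCA lerDl addr_ge0.
Qed.

(* The limit of [f (n + k - m)] as first [k], then [m] tends to infinity along
   one free ultrafilter; the limits of [l ^ k] and [l ^ (- m)] cancel out. *)
Lemma APmap_kills_c0 : exists Phi, APmap Phi /\ forall f, c0 f -> Phi f = zero_s R.
Proof.
have [U [UU EU]] := ultraFilterLemma eventually_filter.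
pose P := ulim_map U (fun m : nat => @translate R m).
pose Q := ulim_map U (fun m : nat => @translate R (- m%:Z)).
have hP : eqpos P by apply: eqpos_ulim => m; exact: eqpos_translate_map.
have hQ : eqpos Q by apply: eqpos_ulim => m; exact: eqpos_translate_map.
have mP : multiplicative_map P by apply: ulim_map_mul => // m; exact: eqpos_translate_map.
have mQ : multiplicative_map Q by apply: ulim_map_mul => // m; exact: eqpos_translate_map.
exists (fun f => Q (P f)); split; last first.
  move=> f cf; rewrite (_ : P f = zero_s R) ?eqpos0 //.
  apply: funext => n; apply: ulim_mapE; first by move=> m; exact: eqpos_translate_map.
    exact: c0_bounded.
  move=> e e0; have [N fN] := cf e e0; apply: EU.
  exists (`|N| + `|n|).+1%N => // m /= Nm; rewrite subr0; apply: fN.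
  by lia.
apply: multiplicative_APmap; first exact: eqpos_comp.
  by move=> f g bf bg; rewrite mP // mQ //; exact: eqpos_bounded.
move=> l l1; have l0 : l != 0 by rewrite -normr_eq0 l1 oner_eq0.
have bx := AP_bounded (AP_xl l1).
have T (s : nat -> int) n : ulim_map U (fun m => @translate R (s m)) (xl l) n
    = ulim U (fun m => l ^ (s m)) * l ^ n.
  apply: ulim_mapE => //; first by move=> m; exact: eqpos_translate_map.
  rewrite /translate /xl; under eq_fun do rewrite addrC expfzDr //.
  apply: is_ulimM; last exact: is_ulim_cst.
  by have [M hM] := bx; apply: ulimP; exists M => i; exact: hM.
pose L := ulim U (fun m : nat => l ^ m).
pose L' := ulim U (fun m : nat => l ^ (- m%:Z)).
have PE : P (xl l) = scale_s L (xl l) by apply: funext => n; rewrite /P T.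
have QE : Q (xl l) = scale_s L' (xl l) by apply: funext => n; rewrite /Q T.
rewrite PE eqposZ // QE; apply: funext => n; rewrite /scale_s mulrA.
suff -> : L * L' = 1 by rewrite mul1r.
have : is_ulim U (fun m : nat => l ^ m * l ^ (- m%:Z)) (L * L').
  have [M hM] := bx.
  apply: is_ulimM; apply: ulimP; exists M => i; first exact: (hM i%:Z).
  exact: (hM (- i%:Z)).
under eq_fun do rewrite -expfzDr // subrr expr0z.
by move/is_ulim_uniq; apply; exact: is_ulim_cst.
Qed.

End EquivariantMaps.

(** * Minimality and rigidity *)

(** Archimedean property of [R]: the inequality is carried to the reals [r = |z|] and [m = M], and
    [2 ^ N] exceeds [m / r] for a suitable [N]. *)
Lemma norm_le_geom_eq0 (R : realType) (z M : R[i]) :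
  (forall k, `|z| <= 2^-1 ^+ k * M) -> z = 0.
Proof.
move=> zM; have M0 : 0 <= M.
  by have := zM 0%N; rewrite expr0 mul1r; apply: le_trans.
have [r zE] : exists r : R, `|z| = real_complex R r.
  by exists (complex.Re `|z|); rewrite RRe_real // ger0_real.
have [m ME] : exists m : R, M = real_complex R m.
  by exists (complex.Re M); rewrite RRe_real // ger0_real.
have m0 : 0 <= m by move: M0; rewrite ME ler0c.
have K k : r <= 2^-1 ^+ k * m.
  by rewrite -lecR -zE rmorphM rmorphXn fmorphV rmorph_nat /= -ME.
apply/eqP/negPn/negP => z0.
have r0 : 0 < r by rewrite -ltcR -zE normr_gt0.
pose N := Num.bound (m / r).
have hN : m / r < 2 ^+ N.
  apply: (@lt_trans _ _ N%:R); first by apply: archi_boundP; rewrite divr_ge0 // ltW.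
  by rewrite -natrX ltr_nat; exact: ltn_expl.
have : r < r.
  apply: (le_lt_trans (K N)).
  by rewrite exprVn ltr_pdivrMl ?exprn_gt0 // -ltr_pdivrMr.
by rewrite ltxx.
Qed.

Section Minimality.
Set Implicit Arguments. Unset Strict Implicit. Unset Printing Implicit Defensive.
Variable R : realType.
Local Notation C := (R[i]).
Local Open Scope classical_set_scope.
Local Open Scope ring_scope.
Implicit Types (f g h : seqZ R) (Phi Psi : seqZ R -> seqZ R).

(* Encodes the seminorm [f |-> sup |Phi f|]: a larger set is a smaller seminorm. *)
Definition bounds Phi : set (seqZ R * C) :=
  [set p | bounded p.1 /\ forall n, `|Phi p.1 n| <= p.2].

Definition seminorm_minimal Phi := APmap Phi /\
  forall Psi, APmap Psi -> bounds Phi `<=` bounds Psi -> bounds Psi `<=` bounds Phi.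

Lemma seminorm_minimal_ex : exists Phi, seminorm_minimal Phi.
Proof.
(* Zorn's lemma is used with an antisymmetric order, and different maps may have the same seminorm,
   so the order lives on the sets [bounds Phi]. *)
pose T := {A : set (seqZ R * C) | exists Phi, APmap Phi /\ A = bounds Phi}.
pose pt Phi (hP : APmap Phi) : T := exist _ (bounds Phi) (ex_intro _ Phi (conj hP erefl)).
pose le (s t : T) := `[< sval s `<=` sval t >].
have [|s t r /asboolP st /asboolP tr|s t /asboolP st /asboolP ts|F Ftot|[A [Phi [hP AE]]] Amax]
    := @Zorn T le.
- by move=> t; apply/asboolP.
- by apply/asboolP; apply: subset_trans tr.
- case: s t st ts => [A pA] [A' pA'] /= st ts.
  have E : A = A' by apply/seteqP.
  by rewrite {}E in pA st ts *; congr exist; exact: Prop_irrelevance.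
(* An upper bound of the chain [F]: the identity if [F] is empty, otherwise the limit of chosen
   representatives along an ultrafilter containing every final segment. *)
- have [[i0 Fi0]|F0] := pselect (exists i, F i); last first.
    exists (pt _ (@APmap_id R)) => s Fs.
    by case: F0; exists s.
  pose I := {s : T | F s}.
  pose phi (i : I) := projT1 (cid (svalP (sval i))).
  have phiP i : APmap (phi i) /\ sval (sval i) = bounds (phi i).
    by rewrite /phi; case: cid.
  have [|||U [UU hU]] := @ultrafilter_of_base I I setT (fun i => [set j | le (sval i) (sval j)]).
  + by exists (exist _ _ Fi0).
  + move=> i j _ _; case: (Ftot _ _ (svalP i) (svalP j)) => /asboolP ij.
      exists j => // k /= /asboolP jk; split; apply/asboolP => //.
      exact: subset_trans jk.
    exists i => // k /= /asboolP jk; split; apply/asboolP => //.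
    exact: subset_trans jk.
  + by move=> i _; exists i; apply/asboolP.
  have hu : APmap (ulim_map U phi) by apply: APmap_ulim => i; exact: (phiP i).1.
  exists (pt _ hu) => s Fs; apply/asboolP => -[f M] /=.
  pose i : I := exist _ s Fs.
  move=> sf; have bf : bounded f by move: sf; rewrite (phiP i).2 => -[].
  split=> // n /=; apply: is_ulim_norm_le (ulim_mapP _ n bf); last first.
    by move=> j; exact: (phiP j).1.1.
  (* From [s] on in the chain, every [phi j] satisfies the bound [(f, M)], so the limit does too. *)
  apply: filterS (hU i Logic.I) => j /= /asboolP /(_ _ sf).
  by rewrite (phiP j).2 => -[_]; exact.
exists Phi; split=> // Psi hQ le1.
have E : pt _ hQ = exist _ A (ex_intro _ Phi (conj hP AE)).
  by apply: Amax; apply/asboolP; rewrite /= AE.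
by rewrite -AE; move: (congr1 sval E) => /= ->.
Qed.

Lemma bounds_contr Phi Psi : APmap Phi -> APmap Psi ->
  bounds Psi `<=` bounds (fun f => Phi (Psi f)).
Proof.
move=> hP hQ [f M] [bf fM]; split=> //=; apply: (eqpos_contr hP.1) => //.
exact: (eqpos_bounded hQ.1).
Qed.

(* [A] is the average of the first [2 ^ k] powers of [Phi], so that
   [A (f - Phi f)] telescopes. *)
Lemma averages Phi : APmap Phi -> forall k, exists A G, APmap A /\ APmap G /\
  (forall f, bounded f -> G (Phi f) = Phi (G f)) /\ bounds Phi `<=` bounds A /\
  forall f, bounded f ->
    A (sub_s f (Phi f)) = scale_s (2^-1 ^+ k) (sub_s (Phi f) (G (Phi f))).
Proof.
move=> hP; have bP := eqpos_bounded hP.1; elim=> [|k [A [G [hA [hG [cG [sA tA]]]]]]].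
  exists Phi, Phi; do 4!split=> //.
  move=> f bf; rewrite (eqposB hP.1) //; last exact: bP.
  by apply: funext => n; rewrite /scale_s expr0 mul1r.
have bG := eqpos_bounded hG.1; have bA := eqpos_bounded hA.1.
(* [G] is the power [Phi^(2^k)]: the next [2^k] powers have average [A G], and [G G] is the next
   [G]. *)
exists (mid_map A (fun f => A (G f))), (fun f => G (G f)).
split; first by apply: APmap_mid => //; exact: APmap_comp.
split; first exact: APmap_comp.
split; first by move=> f bf; rewrite cG // cG //; exact: bG.
split=> [[f M] [bf fM]|f bf].
  split=> // n; have [_ /(_ n) h1] := sA _ (conj bf fM).
  have gf : bounds Phi (G f, M).
    split=> [|m] /=; first exact: bG.
    by rewrite -cG //; apply: (eqpos_contr hG.1) => //; exact: bP.
  have [_ /(_ n) h2] := sA _ gf.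
  rewrite /mid_map /scale_s /add_s normrM ger0_norm ?invr_ge0 // ler_pdivrMl //.
  by apply: (le_trans (ler_normD _ _)); rewrite mulr2n mulrDl mul1r; exact: lerD.
have bPf := bP _ bf; have bGf := bG _ bf.
rewrite /mid_map tA // (eqposB hG.1) // cG // tA //.
apply: funext => n; rewrite /scale_s /add_s /sub_s -!cG //.
by rewrite exprS; ring.
Qed.

(** The averages have no larger seminorm than [Phi], so by minimality their bounds hold for [Phi];
    telescoping makes them at most [2^-k * (M + M)] on [f - Phi f], for every [k]. *)
Lemma seminorm_minimal_idem Phi f : seminorm_minimal Phi -> bounded f ->
  Phi (Phi f) = Phi f.
Proof.
move=> [hP mP] bf; have bP := eqpos_bounded hP.1.
have bd : bounded (sub_s f (Phi f)) by apply: bounded_sub => //; exact: bP.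
have [M fM] := bP _ bf; have M0 : 0 <= M := le_trans (normr_ge0 _) (fM 0).
have H k n : `|Phi (sub_s f (Phi f)) n| <= 2^-1 ^+ k * (M + M).
  have [A [G [hA [hG [cG [sA tA]]]]]] := averages hP k.
  apply: (mP A hA sA (_, _) _).2 => /=; split=> //= m.
  rewrite tA // /scale_s normrM ger0_norm ?exprn_ge0 ?invr_ge0 //.
  rewrite ler_wpM2l ?exprn_ge0 ?invr_ge0 // /sub_s.
  apply: (le_trans (ler_normB _ _)); apply: lerD => //.
  by apply: (eqpos_contr hG.1) => //; exact: bP.
apply: funext => n; apply/eqP; rewrite eq_sym -subr_eq0; apply/eqP.
apply: (@norm_le_geom_eq0 _ _ (M + M)) => k; have := H k n.
by rewrite (eqposB hP.1) //; exact: bP.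
Qed.

(** [G = Phi Psi Phi] is again minimal, hence idempotent, so [G] kills [f - G f]. By minimality
    [Phi] kills it too, and [Phi G = G] gives [Phi f = G f]. *)
Lemma seminorm_minimal_rigid Phi Psi f : seminorm_minimal Phi -> APmap Psi ->
  bounded f -> Phi (Psi (Phi f)) = Phi f.
Proof.
move=> mPhi hQ bf; have [hP mP] := mPhi.
have bP := eqpos_bounded hP.1; have bQ := eqpos_bounded hQ.1.
pose G := fun f => Phi (Psi (Phi f)).
have hPQ : APmap (fun f => Phi (Psi f)) by exact: APmap_comp.
have hG : APmap G by exact: (APmap_comp hPQ hP).
have sG : bounds Phi `<=` bounds G by exact: (bounds_contr hPQ hP).
have mG : seminorm_minimal G.
  split=> // X hX GX; apply: (@subset_trans _ (bounds Phi)) => //.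
  by apply: mP => //; apply: (subset_trans sG).
have bG : bounded (G f) by exact: (eqpos_bounded hG.1).
have G0 : bounds G (sub_s f (G f), 0).
  split=> [|n] /=; first exact: bounded_sub.
  by rewrite (eqposB hG.1) // /sub_s seminorm_minimal_idem // subrr normr0.
have [_ /= P0] := mP G hG sG _ G0.
apply: funext => n; have := P0 n; rewrite (eqposB hP.1) // normr_le0 subr_eq0.
rewrite /G seminorm_minimal_idem //; first by move/eqP.
by apply: bQ; exact: bP.
Qed.

(** Hamana's rigidity: each [Psi Phi] restricts to the identity on the range of [Psi]. So every
    [Phi] is injective there, and [Phi = id] gives idempotence. *)
Definition rigid_map Psi := APmap Psi /\
  forall Phi, APmap Phi -> forall f, bounded f -> Psi (Phi (Psi f)) = Psi f.

Lemma rigid_kills_c0_ex : exists Psi, rigid_map Psi /\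
  forall f, c0 f -> Psi f = zero_s R.
Proof.
have [G mG] := seminorm_minimal_ex; have [T [hT T0]] := @APmap_kills_c0 R.
exists (fun f => G (T f)); split; last by move=> f cf; rewrite T0 // (eqpos0 mG.1.1).
split; first exact: APmap_comp mG.1 hT.
move=> Phi hP f bf.
have bT := eqpos_bounded hT.1 bf.
(* Rigidity of [G] is applied with the inner map [T Phi]. *)
by rewrite (seminorm_minimal_rigid mG (APmap_comp hT hP) bT).
Qed.

Lemma APmap_UCP Phi : APmap Phi -> UCP Phi.
Proof.
move=> [hP _]; split; first exact: eqpos_lin.
by split; [exact: eqpos_one|exact: eqpos_CP].
Qed.

Lemma AP_Zproj_APmap Phi : AP_Zproj Phi -> APmap Phi.
Proof.
move=> [[lP [oP cP]] [_ [sP fP]]]; split=> //; split=> //.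
by move=> f bf; exact: CP_ge0.
Qed.

Lemma rigid_idem Psi : rigid_map Psi -> idem_map Psi.
Proof. by move=> [_ rP] f bf; apply: (rP id). Qed.

Lemma rigid_AP_Zproj Psi : rigid_map Psi -> AP_Zproj Psi.
Proof.
move=> rP; have [hP _] := rP; split; first exact: APmap_UCP.
split; first exact: rigid_idem.
by split; [exact: (eqpos_shift hP.1)|exact: hP.2].
Qed.

(** Rigidity gives [Psi f = Psi Phi Psi f], and for [Phi] below [Psi] the right-hand side collapses
    to [Phi f]. *)
Lemma rigid_minimal Psi : rigid_map Psi -> minimal_AP_Zproj Psi.
Proof.
move=> rP; split; first exact: rigid_AP_Zproj.
move=> Phi /AP_Zproj_APmap hP H f bf.
have bP := eqpos_bounded rP.1.1 bf.
by rewrite -(rP.2 Phi hP f bf) (H _ bP).2 (H _ bf).1.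
Qed.

(** * The Choi-Effros product *)

Section ChoiEffros.
Variable Psi : seqZ R -> seqZ R.
Hypotheses (hPsi : eqpos Psi) (idPsi : idem_map Psi).

(** Kadison-Schwarz for [z = t conj(a) + y], followed by one more application of [Psi], leaves
    [0 <= 2 Re (t conj(w)) + c] for every [t], which forces [w = 0]. *)
Lemma mul_range_ker a y : bounded a -> bounded y -> Psi a = a ->
  Psi y = zero_s R -> Psi (mul_s a y) = zero_s R.
Proof.
move=> ba by_ aE y0; apply: funext => n.
set w := Psi (mul_s a y) n.
have bay : bounded (mul_s a y) by exact: bounded_mul.
have baa := bounded_sqn ba; have byy := bounded_sqn by_.
pose c := Psi (sqn_s y) n.
have c0 : 0 <= c by apply: (eqpos_ge0 hPsi) => // k; exact: sqn_s_ge0.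
have K (t : C) : 0 <= t * w^* + t^* * w + c.
  pose z := add_s (scale_s t (conj_s a)) y.
  have bz : bounded z by apply: bounded_add => //; apply: bounded_scale; exact: bounded_conj.
  pose q := add_s (scale_s t (conj_s (mul_s a y))) (add_s (scale_s t^* (mul_s a y)) (sqn_s y)).
  have bq2 : bounded (add_s (scale_s t^* (mul_s a y)) (sqn_s y)).
    by apply: bounded_add => //; exact: bounded_scale.
  have bq : bounded q.
    by apply: bounded_add => //; apply: bounded_scale; exact: bounded_conj.
  have zE : sqn_s z = add_s (scale_s (t * t^*) (sqn_s a)) q.
    apply: funext => k; rewrite /sqn_s /z /q /mul_s /conj_s /add_s /scale_s /sqn_s /mul_s /conj_s.
    by rewrite !rmorphD !rmorphM /= conjCK; ring.
  have Pz : Psi z = scale_s t (conj_s a).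
    have bca := bounded_conj ba.
    rewrite /z (eqpos_lin hPsi).2 // eqpos_conj // aE y0.
    by apply: funext => k; rewrite /add_s addr0.
  have L k : scale_s (t * t^*) (sqn_s a) k <= Psi (sqn_s z) k.
    apply: (le_trans _ (eqpos_schwarz hPsi k bz)); rewrite Pz.
    rewrite /sqn_s /mul_s /conj_s /scale_s rmorphM /= conjCK.
    by rewrite [leRHS]mulrACA [X in _ <= _ * X]mulrC.
  (* By idempotence, [Psi] of the right-hand side is again [Psi (|z|^2)], and the terms in [|t|^2]
     cancel. *)
  have := eqpos_le hPsi n (bounded_scale (t * t^*) baa) (eqpos_bounded hPsi (bounded_sqn bz)) L.
  rewrite (idPsi (bounded_sqn bz)) zE.
  rewrite (eqpos_lin hPsi).2 // eqposZ // /add_s lerDl.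
  rewrite /q (eqpos_lin hPsi).2 //; last exact: bounded_conj.
  rewrite (eqpos_lin hPsi).2 // eqpos_conj // /add_s /scale_s /conj_s -/w -/c addrA.
  by [].
have [//|w0] := eqVneq w 0.
have n0 : 0 < w * w^* by rewrite mul_conjC_gt0.
(* This [t] turns the linear part into [-2 (c + 1)], so that the total is [-(c + 2) < 0]. *)
have := K (- ((c + 1) / (w * w^*)) * w).
have cr : ((c + 1) / (w * w^*))^* = (c + 1) / (w * w^*).
  by rewrite conj_Creal // ger0_real // divr_ge0 ?addr_ge0 // ltW.
rewrite rmorphM rmorphN /= cr.
have -> : - ((c + 1) / (w * w^*)) * w * w^* + - ((c + 1) / (w * w^*)) * w^* * w + c
  = - (c + 2).
  by field; rewrite w0 conjC_eq0 w0.
rewrite oppr_ge0 => h; have : 0 < c + 2 by rewrite ltr_wpDl.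
by rewrite (le_gtF h).
Qed.

(** With [c = Psi (a b)], the defect [y = c - a b] lies in the kernel, and
    [|y|^2 = conj(c) y - conj(a) (conj(b) y)]; multiplication by conjugates of range elements
    preserves the kernel. *)
Lemma mul_defect_null a b : bounded a -> bounded b -> Psi a = a -> Psi b = b ->
  Psi (sqn_s (sub_s (Psi (mul_s a b)) (mul_s a b))) = zero_s R.
Proof.
move=> ba bb aE bE.
have bab : bounded (mul_s a b) by exact: bounded_mul.
set c := Psi (mul_s a b); set y := sub_s c _.
have bc : bounded c by exact: eqpos_bounded.
have by_ : bounded y by exact: bounded_sub.
have y0 : Psi y = zero_s R.
  by rewrite eqposB // /c idPsi //; apply: funext => n; rewrite /sub_s subrr.
have E : sqn_s y = sub_s (mul_s (conj_s c) y) (mul_s (conj_s a) (mul_s (conj_s b) y)).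
  apply: funext => n; rewrite /sqn_s /y /sub_s /mul_s /conj_s rmorphB rmorphM /=; ring.
have bca := bounded_conj ba; have bcb := bounded_conj bb; have bcc := bounded_conj bc.
have bby : bounded (mul_s (conj_s b) y) by exact: bounded_mul.
rewrite E eqposB //; try exact: bounded_mul.
rewrite !mul_range_ker ?eqpos_conj ?aE ?bE ?idPsi //.
by apply: funext => n; rewrite /sub_s subrr.
Qed.

Lemma null_ultrafilter : exists U : set_system int, UltraFilter U /\
  forall q, bounded q -> (forall k, 0 <= q k) -> Psi q 0 = 0 ->
  forall eps : C, 0 < eps -> U [set m | q m < eps].
Proof.
pose D : set (seqZ R * C) :=
  [set p | [/\ bounded p.1, forall k, 0 <= p.1 k, Psi p.1 0 = 0 & 0 < p.2]].
have [|||U [UU hU]] := @ultrafilter_of_base _ int D (fun p => [set m | p.1 m < p.2]).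
- exists (zero_s R, 1); split=> //=; first exact: bounded_cst.
  by rewrite eqpos0.
- move=> [q d] [q' d'] [/= bq q0 qz d0] [/= bq' q0' qz' d0'].
  (* Two members are refined by [q + q'] with the smaller bound; positive elements of [R[i]] are
     comparable, so the minimum makes sense. *)
  have cmp : d >=< d' by apply: real_comparable; exact: gtr0_real.
  exists (add_s q q', Order.min d d').
    split=> /=; first exact: bounded_add.
    - by move=> k; rewrite addr_ge0.
    - by rewrite eqposD // /add_s qz qz' addr0.
    - by rewrite comparable_lt_min // d0.
  move=> m /=; rewrite comparable_lt_min // => /andP[h1 h2]; split=> /=.
    by apply: le_lt_trans h1; rewrite lerDl.
  by apply: le_lt_trans h2; rewrite lerDr.
- move=> [q d] [/= bq q0 qz d0]; apply: contrapT => H.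
  have dq k : d <= q k.
    rewrite real_leNgt ?ger0_real // ?ltW //; apply/negP => h; apply: H.
    by exists k.
  have := eqpos_le hPsi 0 (bounded_cst d) bq dq; rewrite eqpos_cst // qz.
  by rewrite /cst_s (lt_geF d0).
by exists U; split=> // q bq q0 qz e e0; apply: (hU (q, e)).
Qed.

End ChoiEffros.

Lemma multiplicative_lift Psi : APmap Psi -> idem_map Psi ->
  exists T, APmap T /\ multiplicative_map T /\
    forall f g, bounded f -> bounded g ->
      T (Psi (mul_s (Psi f) (Psi g))) = mul_s (T (Psi f)) (T (Psi g)).
Proof.
move=> hP iP; have [U [UU hU]] := null_ultrafilter hP.1.
have bP := eqpos_bounded hP.1.
have hS (m : int) : eqpos (@translate R m) by exact: eqpos_translate_map.
pose T := ulim_map U (@translate R).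
have hT : eqpos T by exact: eqpos_ulim.
have mT : multiplicative_map T by exact: ulim_map_mul.
(* Equivariance moves the hypothesis from [n] to the origin, where [U] is defined:
   [|g (n + m)|^2 < e^2] for [U]-many [m]. *)
have N g n : bounded g -> Psi (sqn_s g) n = 0 -> T g n = 0.
  move=> bg gn; apply: ulim_mapE => // e e0.
  have := hU (translate n (sqn_s g)) (bounded_translate n (bounded_sqn bg)).
  have bs := bounded_sqn bg.
  have -> : Psi (translate n (sqn_s g)) 0 = 0.
    by rewrite (eqpos_translate hP.1) // /translate add0r.
  move=> /(_ (fun k => sqn_s_ge0 _ _) erefl _ (exprn_gt0 2 e0)).
  apply: filterS => m /=; rewrite subr0 /translate /sqn_s /mul_s /conj_s -normCK addrC.
  by rewrite ltr_pXn2r ?nnegrE // ltW.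
exists T; split; last split=> //.
  (* [|f - f n|^2] is almost periodic, so [Psi] fixes it, and it vanishes at [n]; hence
     [T f n = f n]. *)
  split=> // f Af; have bf := AP_bounded Af; apply: funext => n.
  have bc := bounded_cst (f n); have bd := bounded_sub bf bc.
  have := N _ n bd; rewrite hP.2; last by apply: AP_sqn; exact: AP_sub_cst.
  rewrite (eqposB hT bf bc) (eqpos_cst hT).
  rewrite /sqn_s /mul_s /sub_s /cst_s subrr mul0r => /(_ erefl) /eqP.
  by rewrite subr_eq0 => /eqP.
move=> f g bf bg; have ba := bP _ bf; have bb := bP _ bg.
have bab := bounded_mul ba bb.
(* By multiplicativity, the claim is that [T] kills the defect [Psi (a b) - a b] for [a = Psi f] and
   [b = Psi g]. *)
rewrite -mT //; apply: funext => n; apply/eqP; rewrite -subr_eq0.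
rewrite -[X in X == _]/(sub_s _ _ n) -(eqposB hT) //; last exact: bP.
rewrite N //; first by apply: bounded_sub => //; exact: bP.
by rewrite mul_defect_null // ?iP //; exact: hP.1.
Qed.

End Minimality.

(** * Properness of the envelope and the projection onto a C*-subalgebra *)

Theorem theorem2p16 (R : realType) :
  (* I_Z(AP(Z)) is not all of l^oo(Z) *)
  (forall Psi : seqZ R -> seqZ R, minimal_AP_Zproj Psi ->
     exists f, bounded f /\ Psi f <> f) /\
  (* the map Phi *)
  (exists Phi : seqZ R -> seqZ R,
     UCP Phi /\ idem_map Phi /\ Zequivariant Phi /\
     Cstar_subalg (rangeM Phi) /\
     (exists Psi, minimal_AP_Zproj Psi /\ star_iso Psi Phi) /\
     (forall f, AP f -> Phi f = f) /\
     (forall f, c0 f -> Phi f = zero_s R) /\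
     (forall l : R[i], `|l| = 1 <-> in_sigma Phi l)).
Proof.
have [Psi [rPsi Psi0]] := @rigid_kills_c0_ex R; have [hPsi rP] := rPsi.
have iPsi := rigid_idem rPsi; have bPsi := eqpos_bounded hPsi.1.
split.
  (* If [X] were the identity, [Psi] would lie below it and equal it by minimality; but [Psi] kills
     the point mass at 0. *)
  move=> X [_ mX]; apply: contrapT => H.
  have XE f : bounded f -> X f = f.
    by move=> bf; apply: contrapT => XF; apply: H; exists f.
  pose d : seqZ R := fun n => (n == 0)%:R.
  have cd : c0 d.
    move=> e e0; exists 0 => n; rewrite normr_gt0 => n0.
    by rewrite /d (negbTE n0) normr0.
  have bd : bounded d := c0_bounded cd.
  have := mX Psi (rigid_AP_Zproj rPsi) => /(_ _ d bd).
  rewrite XE // Psi0 // => H2.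
  have /(congr1 (fun f => f 0)) : zero_s R = d.
    by apply: H2 => f bf; rewrite !XE //; exact: bPsi.
  by rewrite /d eqxx => /eqP; rewrite eq_sym oner_eq0.
have [T [hT [mT TP]]] := multiplicative_lift hPsi iPsi.
have bT := eqpos_bounded hT.1.
pose Phi f := T (Psi f).
have hPhi : APmap Phi by exact: APmap_comp.
have bPhi := eqpos_bounded hPhi.1.
(* [Psi T Psi = Psi] by rigidity, so [T Psi] is idempotent and [Psi] inverts [T] on the range of
   [Psi]. *)
have iPhi : idem_map Phi by move=> f bf; rewrite /Phi rP.
have TPsi f g : rangeM Psi f -> rangeM Psi g -> T f = T g -> f = g.
  move=> [f' [bf ->]] [g' [bg ->]] /(congr1 Psi).
  by rewrite !rP.
exists Phi; split; first exact: APmap_UCP.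
split=> //; split; first exact: (eqpos_shift hPhi.1).
split.
  split; first by move=> _ [f [bf ->]]; exact: bPhi.
  split; first by exists (one_s R); rewrite (eqpos_one hPhi.1); split=> //; exact: bounded_cst.
  split.
    move=> _ _ [f [bf ->]] [g [bg ->]]; exists (add_s f g).
    by rewrite (eqposD hPhi.1) //; split=> //; exact: bounded_add.
  split.
    move=> a _ [f [bf ->]]; exists (scale_s a f).
    by rewrite (eqposZ hPhi.1) //; split=> //; exact: bounded_scale.
  split.
    move=> _ _ [f [bf ->]] [g [bg ->]]; exists (mul_s (Psi f) (Psi g)).
    by rewrite /Phi TP //; split=> //; apply: bounded_mul; exact: bPsi.
  split.
    move=> _ [f [bf ->]]; exists (conj_s f).
    by rewrite (eqpos_conj hPhi.1) //; split=> //; exact: bounded_conj.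
  (* The range is the fixed-point set, which is uniformly closed. *)
  move=> f H; have [bf fE] : bounded f /\ Phi f = f.
    apply: (eqpos_fixed_closed hPhi.1) => e e0.
    have [_ [[g [bg ->]] fg]] := H e e0; exists (Phi g); split=> //.
    by split; [exact: bPhi|exact: iPhi].
  by exists f.
split.
  exists Psi; split; first exact: rigid_minimal.
  exists T; split; first by move=> _ [f [bf ->]]; exists f.
  split.
    by move=> a _ _ [f [bf ->]] [g [bg ->]]; apply: (eqpos_lin hT.1).2; exact: bPsi.
  split; first by move=> _ _ [f [bf ->]] [g [bg ->]]; exact: TP.
  split; first by move=> _ [f [bf ->]]; apply: (eqpos_conj hT.1); exact: bPsi.
  split; first exact: (eqpos_one hT.1).
  split=> // _ [f [bf ->]]; exists (Psi f); split=> //; by exists f.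
split; first exact: hPhi.2.
split; first by move=> f cf; rewrite /Phi Psi0 // (eqpos0 hT.1).
move=> l; split=> [l1|[]//]; split=> //; exists 1; split; first exact: oner_neq0.
rewrite hPhi.2; last exact: AP_xl.
by apply: funext => n; rewrite /scale_s mul1r.
Qed.
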